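(* For all integers $\ell,n\ge 1$, the triples of statistics $(\mathrm{fmaf},\mathrm{exc},\mathrm{fix})$ and $(\mathrm{fmaj},\mathrm{exc},\mathrm{fix})$ are equidistributed on $G_{\ell,n}$, i.e. for all integers $a,b,c$, $$\#\{\sigma\in G_{\ell,n}:(\mathrm{fmaf}\,\sigma,\mathrm{exc}\,\sigma,\mathrm{fix}\,\sigma)=(a,b,c)\}=\#\{\sigma\in G_{\ell,n}:(\mathrm{fmaj}\,\sigma,\mathrm{exc}\,\sigma,\mathrm{fix}\,\sigma)=(a,b,c)\}.$$ Moreover $$\sum_{\sigma\in G_{\ell,n}}q^{\mathrm{fmaf}\,\sigma}x^{\mathrm{fix}\,\sigma}=\sum_{\sigma\in G_{\ell,n}}q^{\mathrm{fmaj}\,\sigma}x^{\mathrm{fix}\,\sigma}=[\ell]_q[2\ell]_q\cdots[n\ell]_q\sum_{k=0}^n\frac{(x-1)(x-q^\ell)\cdots(x-q^{\ell(k-1)})}{[\ell]_q[2\ell]_q\cdots[k\ell]_q}.$$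
   Context: Let $\ell,n\ge1$, $\zeta=e^{2\pi i/\ell}$, $C_\ell=\{1,\zeta,\dots,\zeta^{\ell-1}\}$, and $\Sigma_{\ell,n}=\{\zeta^jk:0\le j\le\ell-1,\ 1\le k\le n\}$. $G_{\ell,n}$ is the set of permutations $\sigma$ of $\Sigma_{\ell,n}$ with $\sigma(\zeta^jk)=\zeta^j\sigma(k)$ for all $j,k$; such $\sigma$ is written as the word $x_1x_2\cdots x_n$ with $x_i=\sigma(i)\in\Sigma_{\ell,n}$. For $x=\zeta^jk$ write $\varepsilon_x=\zeta^j$, $|x|=k$. Order $C_\ell$ by $1>\zeta>\zeta^2>\cdots>\zeta^{\ell-1}$, and totally order $\Sigma_{\ell,n}$ by: $x<y$ iff $\varepsilon_x<\varepsilon_y$, or $\varepsilon_x=\varepsilon_y$ and $|x|<|y|$ (an integer $i\in[n]$ is identified with $\zeta^0 i$). For a word $w=w_1\cdots w_m$ over this ordered alphabet, $\mathrm{maj}\,w=\sum_{i=1}^{m-1}i\,\chi(w_i>w_{i+1})$ ($\chi$ = indicator; $\mathrm{maj}$ of the empty word is $0$). For $\sigma=x_1\cdots x_n\in G_{\ell,n}$: $\mathrm{FIX}(\sigma)=\{i\in[n]:x_i=i\}$, $\mathrm{fix}\,\sigma=|\mathrm{FIX}(\sigma)|$; $\mathrm{exc}\,\sigma=\sum_{i=1}^n\chi(x_i>i)$; $\mathrm{col}\,\sigma=\sum_{i=1}^n j_i$ where $x_i=\zeta^{j_i}|x_i|$ with $0\le j_i\le\ell-1$. The derangement part $\mathrm{Der}(\sigma)$: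 delete the fixed points from $x_1\cdots x_n$ to get $y_1\cdots y_m$, and set $\mathrm{Der}(\sigma)=z_1\cdots z_m$ with $z_i=\varepsilon_{y_i}\,\mathrm{rank}(|y_i|)$, where rank is the increasing bijection $\{|y_1|,\dots,|y_m|\}\to[m]$. If $\mathrm{FIX}(\sigma)=\{i_1<\dots<i_k\}$, then $\mathrm{maf}\,\sigma=\mathrm{maj}\,\mathrm{Der}(\sigma)+\sum_{j=1}^k(i_j-j)$. Finally $\mathrm{fmaj}\,\sigma=\ell\,\mathrm{maj}\,\sigma+\mathrm{col}\,\sigma$ and $\mathrm{fmaf}\,\sigma=\ell\,\mathrm{maf}\,\sigma+\mathrm{col}\,\sigma$. $[n]_q=1+q+\cdots+q^{n-1}$. *)

(* Defs.v *)
From HB Require Import structures.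
From mathcomp Require Import all_boot all_order all_algebra all_fingroup.
Set Implicit Arguments. Unset Strict Implicit. Unset Printing Implicit Defensive.
Import Order.TTheory GRing.Theory Num.Theory.

(* An element of G_{l,n}: sigma(zeta^j k) = zeta^(j + c k) (p k).
   Encoded as a pair (p, c) of a permutation p of [n] (0-based: 'I_n) and a
   colour function c : [n] -> {0,..,l-1}.  This is a bijection with G_{l,n}. *)
Definition colperm (l n : nat) : finType :=
  ({perm 'I_n} * {ffun 'I_n -> 'I_l})%type.

(* A letter zeta^j k of Sigma_{l,n} is encoded as the pair (j, k).
   (Values are 0-based; only their relative order matters.) *)
Definition letter := (nat * nat)%type.

(* Total order on letters: x < y iff eps_x < eps_y, or eps_x = eps_y and
   |x| < |y|, where 1 > zeta > zeta^2 > ... , i.e. a larger colour exponent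
   means a smaller letter. *)
Definition ltL (x y : letter) : bool :=
  (y.1 < x.1) || ((x.1 == y.1) && (x.2 < y.2)).

Definition maj (w : seq letter) : nat :=
  \sum_(i < (size w).-1) i.+1 * ltL (nth (0, 0) w i.+1) (nth (0, 0) w i).

Section Stats.
Variables l n : nat.
Implicit Type s : colperm l n.

Definition xlet s (i : 'I_n) : letter := (val (s.2 i), val (s.1 i)).

Definition word s : seq letter := [seq xlet s i | i <- enum 'I_n].

Definition isfix s (i : 'I_n) : bool := xlet s i == (0, val i).

Definition fixn s : nat := #|[pred i | isfix s i]|.

Definition exc s : nat := #|[pred i : 'I_n | ltL (0, val i) (xlet s i)]|.

Definition col s : nat := \sum_(i < n) val (s.2 i).

Definition majp s : nat := maj (word s).

Definition nonfix_word s : seq letter :=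
  [seq xlet s i | i <- enum 'I_n & ~~ isfix s i].

(* rank: increasing bijection {|y_1|,...,|y_m|} -> [m] (1-based) *)
Definition rankv (vals : seq nat) (v : nat) : nat :=
  count (fun u => u <= v) vals.

Definition Der s : seq letter :=
  let ys := nonfix_word s in
  [seq (y.1, rankv (map snd ys) y.2) | y <- ys].

Definition fixpos s : seq nat :=
  [seq val i | i <- enum 'I_n & isfix s i].

(* maf = maj Der + sum_j (i_j - j)  (1-based i_j, j; same as 0-based) *)
Definition maf s : nat :=
  maj (Der s) + \sum_(t < size (fixpos s)) (nth 0 (fixpos s) t - t).

Definition fmaj s : nat := l * majp s + col s.
Definition fmaf s : nat := l * maf s + col s.

End Stats.

Definition qint (R : nzRingType) (q : R) (m : nat) : R :=
  (\sum_(t < m) q ^+ t)%R.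

(* Main.v *)
Require Import Defs.
From HB Require Import structures.
From mathcomp Require Import all_boot all_order all_algebra all_fingroup.
From mathcomp Require Import zify ring.
Set Implicit Arguments. Unset Strict Implicit. Unset Printing Implicit Defensive.
Import Order.TTheory GRing.Theory Num.Theory.

(** Conjugating sigma by the permutation that moves its non-fixed positions to
    the front, in order, and its fixed points to the end gives a d fixing exactly
    the last k positions; sigma is recovered from d and the set I of its fixed
    points. The statistics exc, fix and col depend on d and k only, and
    maf sigma = maj (Der sigma) + sum_j (i_j - j), so summing q^maf over I gives
    q^(maj (Der sigma)) times the Gaussian binomial [n choose k].

    The same holds for maj. As in Wachs' treatment of q-derangement numbers,
    replace every fixed point by one letter f, put the excedance letters above f
    and all other letters below f: descents are unchanged, and the word of sigma
    becomes a shuffle of k copies of f with a word w depending on d only. The sum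
    of q^maj over such shuffles is q^(maj w) [n choose k], and w has the descents
    of Der sigma. This proves equidistribution.

    For the formula, let D_m be the sum of q^fmaj over derangements, Q = q^l and
    A_n = [l]_q ... [nl]_q. The above gives sum q^fmaj x^fix = sum_k [n,k]_Q x^k
    D_(n-k). Inserting the letter of absolute value n+1 (a shuffle with k = 1)
    gives A_n as the value at x = 1. It remains to use
    x^r = sum_k [r,k]_Q (x-1)...(x-Q^(k-1)) and A_n / A_k = [n,k]_Q A_(n-k). *)

(** * Major index and Gaussian binomials *)

Lemma maj_rcons2 (w : seq letter) (c a : letter) :
  maj (rcons (rcons w c) a) = maj (rcons w c) + (size w).+1 * ltL a c.
Proof.
rewrite /maj !size_rcons /= big_ord_recr /=; congr (_ + _).
  apply: eq_bigr => i _; have lt_i := ltn_ord i.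
  by rewrite ![nth _ (rcons _ a) _]nth_rcons size_rcons !ltnS (ltnW lt_i) lt_i.
by rewrite ![nth _ (rcons _ a) _]nth_rcons size_rcons ltnn eqxx ltnSn nth_rcons ltnn eqxx.
Qed.

Lemma eq_maj (u w : seq letter) :
    size u = size w ->
    (forall i, i.+1 < size u ->
      ltL (nth (0, 0) u i.+1) (nth (0, 0) u i)
        = ltL (nth (0, 0) w i.+1) (nth (0, 0) w i)) ->
  maj u = maj w.
Proof.
move=> eq_size eq_des; rewrite /maj -eq_size.
by apply: eq_bigr => i _; rewrite eq_des //; have := ltn_ord i; lia.
Qed.

(* [b] marks the positions of the copies of [f]; running out of letters of [w]
   also yields [f]. *)
Fixpoint shuf (f : letter) (w : seq letter) (b : bitseq) : seq letter :=
  match b with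
  | [::] => [::]
  | true :: b' => f :: shuf f w b'
  | false :: b' => head f w :: shuf f (behead w) b'
  end.

Lemma size_shuf f w b : size (shuf f w b) = size b.
Proof. by elim: b w => [|[] b IH] w //=; rewrite IH. Qed.

Lemma shuf_rcons_true f w b : shuf f w (rcons b true) = rcons (shuf f w b) f.
Proof. by elim: b w => [|[] b IH] w //=; rewrite IH. Qed.

Lemma shuf_rcons_false f w c b : count negb b = size w ->
  shuf f (rcons w c) (rcons b false) = rcons (shuf f w b) c.
Proof.
elim: b w => [|[] b IH] w /=; first by case: w.
  by move=> sz_w; rewrite IH.
by case: w => [|a w] //= [sz_w]; rewrite IH.
Qed.

Lemma shuf_map (T : Type) (f : letter) (h : T -> letter) (a : pred T) (r : seq T) :
  shuf f [seq h i | i <- r & ~~ a i] [seq a i | i <- r]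
    = [seq if a i then f else h i | i <- r].
Proof. by elim: r => [|i r IH] //=; case: (a i) => /=; rewrite IH. Qed.

Section GaussBinomial.
Local Open Scope ring_scope.
Variables (R : comNzRingType) (Q : R).

Fixpoint gauss (n k : nat) : R :=
  match n, k with
  | _, 0%N => 1
  | 0%N, _.+1 => 0
  | n'.+1, k'.+1 => gauss n' k' + Q ^+ k * gauss n' k
  end.

Arguments gauss : simpl never.

Lemma gauss0 n : gauss n 0 = 1. Proof. by case: n. Qed.

Lemma gaussS n k : gauss n.+1 k.+1 = gauss n k + Q ^+ k.+1 * gauss n k.+1.
Proof. by []. Qed.

Lemma gauss_small n k : (n < k)%N -> gauss n k = 0.
Proof.
elim: n k => [|n IH] [|k] //= lt_nk.
by rewrite gaussS !IH ?mulr0 ?addr0 // ltnW.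
Qed.

Lemma gaussnn n : gauss n n = 1.
Proof. by elim: n => // n IH; rewrite gaussS IH gauss_small // mulr0 addr0. Qed.

(** The other Pascal rule, with the weight on the first term. Appending an entry to a mask produces
    it: a final [true] comes after [n - k] entries [false]. *)
Lemma gaussS' n k : (k <= n)%N ->
  gauss n.+1 k.+1 = Q ^+ (n - k) * gauss n k + gauss n k.+1.
Proof.
elim: n k => [|n IH] [|k] // le_kn.
- by rewrite gaussS !gauss0 gauss_small // mulr0 mulr1 expr0.
- rewrite gaussS [in LHS](IH 0) // [gauss n.+1 1]gaussS !gauss0 !subn0 expr1 [Q ^+ n.+1]exprS.
  by rewrite -[0.+1]/1%N; ring.
rewrite subSS; move: le_kn; rewrite ltnS leq_eqVlt => /predU1P[->|lt_kn].
  by rewrite subnn !gaussnn gauss_small // expr0 mulr1 addr0.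
rewrite gaussS [in LHS](IH _ (ltnW lt_kn)) [in LHS](IH _ lt_kn) !gaussS.
rewrite (_ : n - k = (n - k.+1).+1)%N; last by lia.
by rewrite !exprS; ring.
Qed.

Lemma gauss1 n : gauss n 1 = \sum_(i < n) Q ^+ i.
Proof.
elim: n => [|n IH]; first by rewrite big_ord0.
by rewrite gaussS' // gauss0 subn0 mulr1 big_ord_recr /= IH addrC.
Qed.

(** The factorial formula with denominators cleared, so that it holds over any commutative ring;
    [gauss i 1] is $[i]_Q$. The induction step rests on $[n+1] = [k+1] + Q^{k+1}[n-k]$. *)
Lemma gauss_fact n k : (k <= n)%N ->
  gauss n k * ((\prod_(i < k) gauss i.+1 1) * \prod_(i < n - k) gauss i.+1 1)
    = \prod_(i < n) gauss i.+1 1.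
Proof.
elim: n k => [|n IH] [|k] // le_kn.
- by rewrite gauss0 !big_ord0 !mulr1.
- by rewrite gauss0 big_ord0 !mul1r subn0.
rewrite gaussS subSS; move: le_kn; rewrite ltnS leq_eqVlt => /predU1P[->|lt_kn].
  rewrite gaussnn gauss_small // subnn big_ord0; ring.
have := IH _ lt_kn; have := IH k (ltnW lt_kn).
have -> : (n - k = (n - k.+1).+1)%N by lia.
rewrite ![\prod_(i < _.+1) _]big_ord_recr /=.
set g := gauss n k; set g' := gauss n _; set A := \prod_(i < k) _.
set B := \prod_(i < n - _) _; set C := \prod_(i < n) _.
move=> E1 E2.
have -> : gauss n.+1 1 = gauss k.+1 1 + Q ^+ k.+1 * gauss (n - k.+1).+1 1.
  rewrite !gauss1; have -> : (n.+1 = k.+1 + (n - k.+1).+1)%N by lia.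
  rewrite big_split_ord /=; congr (_ + _); rewrite big_distrr.
  by apply: eq_bigr => i _; rewrite exprD.
by rewrite [C * _]mulrDr -{1}E1 -E2; ring.
Qed.

(** With $P_k = (x-1)\cdots(x-Q^{k-1})$ one has $xP_k = P_{k+1} + Q^kP_k$, so the coefficients of
    $x^r$ in the basis $P_k$ obey the Pascal rule [gaussS]. *)
Lemma gauss_expansion (x : R) r :
  x ^+ r = \sum_(k < r.+1) gauss r k * \prod_(i < k) (x - Q ^+ i).
Proof.
elim: r => [|r IH]; first by rewrite big_ord1 gauss0 big_ord0 mulr1.
rewrite exprS IH big_distrr /=.
under eq_bigr => k _.
  rewrite (_ : x * _ = gauss r k * \prod_(i < k.+1) (x - Q ^+ i)
                       + Q ^+ k * gauss r k * \prod_(i < k) (x - Q ^+ i)); last first.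
    by rewrite big_ord_recr /=; ring.
  over.
rewrite big_split /= [in RHS]big_ord_recl gauss0 big_ord0 mulr1.
under [in RHS]eq_bigr => k _ do rewrite lift0 gaussS mulrDl.
rewrite big_split /= [X in _ = _ + (_ + X)]big_ord_recr /= gauss_small // mulr0 mul0r addr0.
rewrite [X in _ + X = _]big_ord_recl /= gauss0 big_ord0 !mulr1 expr0.
by rewrite addrCA.
Qed.

End GaussBinomial.

(** * Shuffles with copies of one letter *)

Lemma count_negb (b : bitseq) : count negb b = size b - count_mem true b.
Proof.
rewrite -(count_predC (pred1 true) b) addKn.
by apply: eq_count => -[].
Qed.

Lemma ltLnn : irreflexive ltL.
Proof. by move=> x; rewrite /ltL !ltnn andbF. Qed.

Section Masks.
Local Open Scope ring_scope.
Variable R : comNzRingType.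

Lemma big_tuple_rcons n (P : pred bitseq) (F : bitseq -> R) :
  \sum_(b : n.+1.-tuple bool | P b) F b
    = \sum_(b : n.-tuple bool | P (rcons b false)) F (rcons b false)
    + \sum_(b : n.-tuple bool | P (rcons b true)) F (rcons b true).
Proof.
pose h (p : bool * n.-tuple bool) : n.+1.-tuple bool := [tuple of rcons p.2 p.1].
have h_bij : bijective h.
  apply: inj_card_bij; last by rewrite card_prod !card_tuple !card_bool expnS.
  move=> [x b] [y c] /(congr1 val) /= /rcons_inj [bc ->].
  by congr pair; apply: val_inj.
rewrite (reindex h) /=; last exact: onW_bij.
rewrite -(pair_big_dep xpredT (fun x (b : n.-tuple bool) => P (rcons b x))
  (fun x b => F (rcons b x))) /=.
by rewrite big_bool addrC.
Qed.

Lemma mask_sumS n k (F : bitseq -> R) :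
  \sum_(b : n.+1.-tuple bool | count_mem true b == k) F b
    = \sum_(b : n.-tuple bool | count_mem true b == k) F (rcons b false)
    + (if k is k'.+1
       then \sum_(b : n.-tuple bool | count_mem true b == k') F (rcons b true)
       else 0).
Proof.
rewrite (big_tuple_rcons _ (fun b => count_mem true b == k)); congr (_ + _).
  by apply: eq_bigl => b; rewrite -cats1 count_cat /= !addn0.
case: k => [|k].
  by apply: big_pred0 => b; rewrite -cats1 count_cat /= addn1.
by apply: eq_bigl => b; rewrite -cats1 count_cat /= addn1 eqSS.
Qed.

Lemma mask_sum_gt n k (F : bitseq -> R) : (n < k)%N ->
  \sum_(b : n.-tuple bool | count_mem true b == k) F b = 0.
Proof.
move=> lt_nk; rewrite big_pred0 // => b.
have := count_size (pred1 true) b; rewrite size_tuple => le_bn.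
by apply/negbTE; rewrite neq_ltn (leq_ltn_trans le_bn).
Qed.

Lemma mask_sum0 (F : bitseq -> R) :
  \sum_(b : 0.-tuple bool | count_mem true b == 0%N) F b = F [::].
Proof.
rewrite (big_pred1 [tuple]); first by [].
by move=> b; rewrite [b]tuple0; symmetry; apply/eqP.
Qed.

(** A mask with a single [true] is determined by its position. This turns the insertion of one
    letter into a shuffle with $k = 1$. *)
Lemma mask_sum1 n (F : bitseq -> R) :
  \sum_(b : n.-tuple bool | count_mem true b == 1%N) F b
    = \sum_(i < n) F [seq k == i | k <- enum 'I_n].
Proof.
elim: n F => [|n IH] F; first by rewrite big_ord0 mask_sum_gt.
rewrite mask_sumS (IH (fun b => F (rcons b false))) big_ord_recr /= enum_ordSr.
congr (_ + _).
  apply: eq_bigr => i _; rewrite map_rcons -map_comp; congr (F (rcons _ _)).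
  by rewrite -val_eqE /= gtn_eqF.
have all_false u : all negb u -> u = nseq (size u) false.
  by move=> u_false; apply/all_pred1P; apply: sub_all u_false => -[].
rewrite map_rcons eqxx (all_false [seq k == ord_max | k <- _]); last first.
  apply/allP => _ /mapP[_ /mapP[k _ ->] ->].
  by rewrite -val_eqE /= ltn_eqF.
rewrite 2!size_map size_enum_ord (big_pred1 [tuple of nseq n false]) //= => b.
apply/eqP/eqP => [b0 | ->]; last by rewrite count_nseq mul0n.
apply: val_inj => /=; rewrite [LHS]all_false ?size_tuple //.
move/eqP: b0; rewrite -leqn0 leqNgt -has_count -all_predC.
by apply: sub_all => -[].
Qed.

Lemma shuf_sub f w b : {subset shuf f w b <= f :: w}.
Proof.
elim: b w => [|[] b IH] w //= x; rewrite inE => /predU1P[->|/IH] //.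
- by rewrite mem_head.
- by case: w => [|y w]; rewrite !inE eqxx ?orbT.
by case: w => [|y w] //; rewrite !inE => /orP[]->; rewrite ?orbT.
Qed.

(* Appending a letter [a] makes the induction close: removing the last letter of
   the shuffle gives sums of the same form, with [f] or the last letter of [w] in
   the role of [a]. *)
Lemma shuffle_maj_rcons (Q : R) (f a : letter) (w : seq letter) n k :
    (size w + k)%N = n -> f \notin w ->
  \sum_(b : n.-tuple bool | count_mem true b == k) Q ^+ maj (rcons (shuf f w b) a)
    = Q ^+ (maj (rcons w a) + k * ltL a f) * gauss Q n k.
Proof.
elim: n w k a => [|n IH] w k a.
  move=> /eqP; rewrite addn_eq0 => /andP[/nilP -> /eqP ->] _.
  by rewrite (mask_sum0 (fun b => Q ^+ maj (rcons (shuf f [::] b) a))) mulr1 mul0n addn0.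
move=> size_wk fNw.
rewrite (mask_sumS _ _ (fun b => Q ^+ maj (rcons (shuf f w b) a))).
have sum_true k' : k = k'.+1 ->
    \sum_(b : n.-tuple bool | count_mem true b == k')
      Q ^+ maj (rcons (shuf f w (rcons b true)) a)
    = Q ^+ (n.+1 * ltL a f + maj (rcons w f)) * gauss Q n k'.
  move=> Dk; have size_wk' : (size w + k' = n)%N by lia.
  have := IH w k' f size_wk' fNw; rewrite ltLnn muln0 addn0.
  rewrite exprD -mulrA => <-; rewrite mulr_sumr; apply: eq_bigr => b _.
  by rewrite shuf_rcons_true maj_rcons2 size_shuf size_tuple -exprD addnC.
case/lastP: w => [|w c] in size_wk fNw sum_true *.
  (* For empty [w] a mask ending in [false] would need $n+1$ entries [true] among its first $n$, so
     only masks ending in [true] remain. *)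
  rewrite (mask_sum_gt (fun b => Q ^+ maj (rcons (shuf f [::] (rcons b false)) a))) ?add0r -?size_wk //.
  case: k => // k in size_wk sum_true *.
  rewrite sum_true //; move: size_wk => [<-].
  by rewrite !gaussnn /maj !big_ord0 addnC.
have size_wk' : (size w + k)%N = n by move: size_wk; rewrite size_rcons addSn => -[].
move: (fNw); rewrite mem_rcons inE negb_or => /andP[fNc fNw'].
have -> : \sum_(b : n.-tuple bool | count_mem true b == k)
      Q ^+ maj (rcons (shuf f (rcons w c) (rcons b false)) a)
    = Q ^+ (n.+1 * ltL a c + (maj (rcons w c) + k * ltL c f)) * gauss Q n k.
  rewrite exprD -mulrA -(IH w) // mulr_sumr; apply: eq_bigr => b /eqP count_b.
  rewrite shuf_rcons_false; last by rewrite count_negb size_tuple count_b -size_wk' addnK.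
  by rewrite maj_rcons2 size_shuf size_tuple -exprD addnC.
(* The position of [a] selects the Pascal rule. If $c<f$, it is [gaussS] when [a] is below both or
   neither of [c] and [f], and [gaussS'] when [a] is below [f] only. If $f<c$, it is [gaussS'] when
   [a] is below both or neither, and [gaussS] when [a] is below [c] only. *)
have trich : [\/ [/\ ltL c f, ~~ ltL f c & (ltL a c -> ltL a f)]
   | [/\ ltL f c, ~~ ltL c f & (ltL a f -> ltL a c)]].
  move: fNc; rewrite /ltL -pair_eqE /pair_eq /=; clear. 
  case: a c f => [a1 a2] [c1 c2] [f1 f2] /= H.
  by case: (boolP ((f1 < c1) || (c1 == f1) && (c2 < f2)))%N => Hc; [left | right]; split; lia.
rewrite maj_rcons2; case: k => [|k] in size_wk size_wk' sum_true *.
  rewrite addr0 !gauss0 !mul0n !addn0 !mulr1 -size_wk' addn0; congr (_ ^+ _); lia.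
rewrite sum_true // maj_rcons2 -!size_wk'; set M := maj _; set m := size w.
have gS := gaussS Q (m + k.+1) k; have gS' := @gaussS' _ Q (m + k.+1) k.
rewrite (_ : m + k.+1 - k = m.+1)%N in gS'; last by lia.
have {}gS' := gS' (leq_trans (leqnSn k) (leq_addl m k.+1)).
have -> : ((m + k.+1).+1 = m.+1 + k.+1)%N by lia.
move: gS gS'; rewrite (_ : (m + k.+1).+1 = m.+1 + k.+1)%N; last by lia.
move: (gauss Q (m + k.+1) k) (gauss Q (m + k.+1) k.+1) (gauss _ _ _) => g g' G gS gS'.
case: trich => -[-> /negbTE-> ]; case: (ltL a f); case: (ltL a c) => [] // H; try by have := H isT.
all: rewrite /= ?muln0 ?muln1 ?addn0 ?add0n ?exprD; first [rewrite gS; ring | rewrite gS'; ring].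
Qed.

Lemma shuffle_maj (Q : R) (f : letter) (w : seq letter) n k :
    (size w + k)%N = n -> f \notin w ->
  \sum_(b : n.-tuple bool | count_mem true b == k) Q ^+ maj (shuf f w b)
    = Q ^+ maj w * gauss Q n k.
Proof.
(* The letter [a] has the top colour and the largest absolute value present, so appending it creates
   no descent. *)
move=> size_wk fNw; pose a : letter := (0%N, \max_(x <- f :: w) x.2).
have le_a x : x \in f :: w -> ltL a x = false.
  move=> fw_x; rewrite /ltL ltn0 /= ltnNge.
  by rewrite (leq_bigmax_seq (F := fun y : letter => y.2)) ?andbF.
have maj_rcons_a u : {subset u <= f :: w} -> maj (rcons u a) = maj u.
  case/lastP: u => [|u c] sub_u; first by rewrite /maj !big_ord0.
  by rewrite maj_rcons2 le_a ?muln0 ?addn0 // sub_u // mem_rcons mem_head.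
have := shuffle_maj_rcons Q a size_wk fNw.
rewrite le_a ?mem_head // muln0 addn0 maj_rcons_a => [<-|x]; last first.
  by rewrite inE orbC => ->.
apply: eq_bigr => b _; rewrite maj_rcons_a //.
exact: shuf_sub.
Qed.

(** This is the number of pairs formed by a [false] and a later [true]. On the mask of fixed points
    it is the term $\sum_j (i_j-j)$ of maf. *)
Definition mask_inv (b : bitseq) : nat :=
  let s := [seq i <- iota 0 (size b) | nth false b i] in
  \sum_(t < size s) (nth 0%N s t - t).

Lemma size_true_positions (b : bitseq) :
  size [seq i <- iota 0 (size b) | nth false b i] = count_mem true b.
Proof.
rewrite size_filter -{3}(mkseq_nth false b) count_map.
by apply: eq_count => i /=; rewrite eqb_id.
Qed.

Lemma true_positions_rcons (b : bitseq) x :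
  [seq i <- iota 0 (size (rcons b x)) | nth false (rcons b x) i]
    = [seq i <- iota 0 (size b) | nth false b i] ++ nseq x (size b).
Proof.
rewrite size_rcons -addn1 iotaD filter_cat; congr (_ ++ _).
  by apply: eq_in_filter => i; rewrite mem_iota => /= lt_i; rewrite nth_rcons lt_i.
by rewrite /= nth_rcons ltnn eqxx; case: x.
Qed.

Lemma mask_inv_rcons b x :
  mask_inv (rcons b x) = (mask_inv b + x * (size b - count_mem true b))%N.
Proof.
rewrite /mask_inv true_positions_rcons.
set s := filter _ _; case: x; last by rewrite cats0 mul0n addn0.
rewrite size_cat addn1 big_ord_recr /= mul1n nth_cat ltnn subnn /=.
congr (_ + _)%N; last by rewrite size_true_positions.
by apply: eq_bigr => t _; rewrite nth_cat ltn_ord.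
Qed.

Lemma mask_inv_sum (Q : R) n k :
  \sum_(b : n.-tuple bool | count_mem true b == k) Q ^+ mask_inv b = gauss Q n k.
Proof.
elim: n k => [|n IH] k.
  case: k => [|k]; last by rewrite (mask_sum_gt (fun b => Q ^+ mask_inv b)).
  by rewrite (mask_sum0 (fun b => Q ^+ mask_inv b)) gauss0 /mask_inv big_ord0.
rewrite (mask_sumS _ _ (fun b => Q ^+ mask_inv b)).
under eq_bigr => b _ do rewrite mask_inv_rcons mul0n addn0.
rewrite IH; case: k => [|k]; first by rewrite !gauss0 addr0.
have [lt_nk | le_kn] := ltnP n k.
  rewrite (mask_sum_gt (fun b => Q ^+ mask_inv (rcons b true))) //.
  by rewrite !gauss_small ?addr0 // ltnW.
rewrite gaussS' // addrC -(IH k) mulr_sumr; congr (_ + _).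
apply: eq_bigr => b /eqP count_b.
by rewrite mask_inv_rcons mul1n count_b size_tuple -exprD addnC.
Qed.

End Masks.

(** * Fixed points and standardization *)

(* Position reached by [i] when the fixed points, marked [true] in [b], are
   moved behind all other positions, both groups keeping their order. *)
Definition standard_pos (b : bitseq) (i : nat) : nat :=
  if nth false b i then count negb b + count_mem true (take i b)
  else count negb (take i b).

Lemma count_take_ltn (a : pred bool) b i j :
  i < j -> j <= size b -> a (nth false b i) ->
  count a (take i b) < count a (take j b).
Proof.
move=> lt_ij le_jb a_i; rewrite -(subnKC (ltnW lt_ij)) takeD count_cat.
rewrite (drop_nth false) ?(leq_trans lt_ij) // -[j - i]prednK ?subn_gt0 //=.
by rewrite a_i -[ltnLHS]addn0 ltn_add2l.
Qed.

Lemma standard_pos_mono b i j :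
    i < size b -> j < size b -> ~~ nth false b i -> ~~ nth false b j ->
  (standard_pos b i < standard_pos b j) = (i < j).
Proof.
move=> lt_i lt_j b_i b_j; rewrite /standard_pos (negbTE b_i) (negbTE b_j).
case: (ltngtP i j) => [lt_ij|lt_ji|->]; last by rewrite ltnn.
  by rewrite count_take_ltn // ltnW.
by rewrite ltnNge ltnW // count_take_ltn // ltnW.
Qed.

Lemma standard_pos_ge b i : i < size b ->
  (count negb b <= standard_pos b i) = nth false b i.
Proof.
move=> lt_i; rewrite /standard_pos; case: ifPn => b_i; first by rewrite leq_addr.
by rewrite -{1}[b]take_size leqNgt count_take_ltn.
Qed.

Lemma standard_pos_ltn b i : i < size b -> standard_pos b i < size b.
Proof.
move=> lt_i; have [b_i|] := boolP (nth false b i); last first.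
  rewrite -standard_pos_ge // -ltnNge => /leq_trans -> //.
  by rewrite count_size.
rewrite /standard_pos b_i count_negb -{2}(subnK (count_size (pred1 true) b)) ltn_add2l.
by rewrite -{2}[b]take_size count_take_ltn ?b_i.
Qed.

(** The image tells whether its source is marked, by [standard_pos_ge]; within each of the two
    groups the prefix counts increase strictly. *)
Lemma standard_pos_inj b i j : i < size b -> j < size b ->
  standard_pos b i = standard_pos b j -> i = j.
Proof.
move=> lt_i lt_j eq_ij; have := standard_pos_ge lt_i.
rewrite eq_ij standard_pos_ge // => b_ij; have b_ji := esym b_ij.
move: eq_ij; rewrite /standard_pos b_ji.
case b_j: (nth false b j) in b_ji *; [move/addnI|];
  case: (ltngtP i j) => // lt_ij eq_ij; exfalso.
- by have := count_take_ltn (a := pred1 true) lt_ij (ltnW lt_j); rewrite b_ji eq_ij ltnn => /(_ isT).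
- by have := count_take_ltn (a := pred1 true) lt_ij (ltnW lt_i); rewrite b_j eq_ij ltnn => /(_ isT).
- by have := count_take_ltn (a := negb) lt_ij (ltnW lt_j); rewrite b_ji eq_ij ltnn => /(_ isT).
- by have := count_take_ltn (a := negb) lt_ij (ltnW lt_i); rewrite b_j eq_ij ltnn => /(_ isT).
Qed.

Section Standardization.
Variable n : nat.
Implicit Type b : n.-tuple bool.

Lemma standard_ord_subproof b (i : 'I_n) : standard_pos b i < n.
Proof. by have := @standard_pos_ltn b i; rewrite size_tuple => ->. Qed.

Lemma standard_ord_inj b : injective (fun i => Ordinal (standard_ord_subproof b i)).
Proof.
move=> i j /(congr1 val)/= /standard_pos_inj; rewrite size_tuple => eq_ij.
by apply: val_inj; apply: eq_ij.
Qed.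

Definition standard_perm b : {perm 'I_n} := perm (@standard_ord_inj b).

Lemma standard_permE b i : standard_perm b i = standard_pos b i :> nat.
Proof. by rewrite permE. Qed.

End Standardization.

Section Conjugation.
Variables l n : nat.
Implicit Types (s d : colperm l n) (t : {perm 'I_n}) (b : n.-tuple bool).

(** Conjugation by [t] viewed as an element with all colours trivial, so colours merely travel with
    their positions. *)
Definition colconj s t : colperm l n :=
  ((s.1 ^ t)%g, [ffun i => s.2 ((t^-1)%g i)]).

Lemma colconjK t : cancel (colconj^~ t) (colconj^~ (t^-1)%g).
Proof.
case=> p c; rewrite /colconj /= conjgK; congr pair.
by apply/ffunP => i; rewrite !ffunE invgK permK.
Qed.

Lemma colconjVK t : cancel (colconj^~ (t^-1)%g) (colconj^~ t).
Proof. by move=> s; rewrite -{2}[t]invgK colconjK. Qed.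

Lemma xlet_colconj s t i : xlet (colconj s t) (t i) = (val (s.2 i), val (t (s.1 i))).
Proof. by rewrite /xlet /= permJ ffunE permK. Qed.

Lemma isfix_colconj s t i : isfix (colconj s t) (t i) = isfix s i.
Proof.
rewrite /isfix xlet_colconj /xlet -!pair_eqE /pair_eq /=.
by rewrite !val_eqE (inj_eq perm_inj).
Qed.

(** Standardization is increasing on non-fixed indices only. By this lemma the absolute values of
    the non-fixed letters are such indices too. *)
Lemma isfix_image s i : ~~ isfix s i -> ~~ isfix s (s.1 i).
Proof.
apply: contra => fix_si; have [_ /val_inj/perm_inj si] := eqP fix_si.
by rewrite -{1}si.
Qed.

Lemma col_colconj s t : Defs.col (colconj s t) = Defs.col s.
Proof.
rewrite /Defs.col (reindex_inj (@perm_inj _ t)) /=.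
by apply: eq_bigr => i _; rewrite ffunE permK.
Qed.

Definition fixmask s : n.-tuple bool := [tuple isfix s i | i < n].

Lemma fixmaskE s : fixmask s = [seq isfix s i | i <- enum 'I_n] :> seq bool.
Proof. by []. Qed.

Lemma nth_fixmask s (i : 'I_n) : nth false (fixmask s) i = isfix s i.
Proof. by rewrite -tnth_nth tnth_mktuple. Qed.

Definition fixes_top d k := [forall i : 'I_n, isfix d i == (n - k <= i)].

(** For a given mask [b], conjugation by [standard_perm b] thus identifies the elements with fixed
    points at [b] with those fixing exactly the last positions. *)
Lemma fixmask_eq s b :
  (fixmask s == b) = fixes_top (colconj s (standard_perm b)) (count_mem true b).
Proof.
have topE (i : 'I_n) : (n - count_mem true b <= standard_perm b i) = tnth b i.
  rewrite standard_permE -{1}(size_tuple b) -count_negb standard_pos_ge ?size_tuple //.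
  by rewrite -tnth_nth.
apply/eqP/forallP => [Db j | top_b].
  rewrite -[j](permKV (standard_perm b)) topE isfix_colconj -Db.
  by rewrite tnth_mktuple.
apply: eq_from_tnth => i; rewrite tnth_mktuple -topE.
by rewrite -(eqP (top_b _)) isfix_colconj.
Qed.

Definition standardize s := colconj s (standard_perm (fixmask s)).

Lemma fixn_count s : fixn s = count_mem true (fixmask s).
Proof.
rewrite /fixn cardE size_filter fixmaskE count_map enumT.
by apply: eq_count => i /=; rewrite inE eqb_id.
Qed.

Lemma standard_pos_nonfix s (i j : 'I_n) : ~~ isfix s i -> ~~ isfix s j ->
  (standard_pos (fixmask s) i < standard_pos (fixmask s) j) = (i < j).
Proof. by move=> *; rewrite standard_pos_mono ?size_tuple ?nth_fixmask. Qed.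

(** Only an uncoloured letter at a non-fixed position can be an excedance, and there standardization
    preserves the comparison of position and value. *)
Lemma exc_standardize s : exc (standardize s) = exc s.
Proof.
rewrite /exc -!sum1_card (reindex_inj (@perm_inj _ (standard_perm (fixmask s)))) /=.
apply: eq_bigl => i; rewrite !inE xlet_colconj /xlet /ltL !ltn0 /=.
have [fix_i|nfix_i] := boolP (isfix s i).
  by case/eqP: (fix_i) => _ /val_inj->; rewrite !ltnn.
by rewrite !standard_permE standard_pos_nonfix ?isfix_image.
Qed.


(* The three classes of letters become three blocks of the order, excedances
   above the letter [(0, 0)] of a fixed point and all other letters below it;
   this does not affect the descents of the word. *)
Definition block_letter (g : nat -> nat) (i : nat) (x : letter) : letter :=
  if x == (0, i) then (0, 0)
  else if (x.1 == 0) && (i < x.2) then (0, (g x.2).+1) else (x.1.+1, g x.2).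

(** Within a class [g] preserves the order. Between uncoloured letters of different classes, the
    neighbouring positions [i] and [i.+1] already force the order: the values differ, an excedance
    exceeds its position, and a letter of the lower class lies below its own. *)
Lemma ltL_block_letter g i (x y : letter) :
    x.2 != y.2 ->
    (x != (0, i) -> y != (0, i.+1) ->
       ((g x.2 < g y.2) = (x.2 < y.2)) * ((g y.2 < g x.2) = (y.2 < x.2))) ->
  ltL (block_letter g i.+1 y) (block_letter g i x) = ltL y x.
Proof.
case: x y => [c v] [c' v'] /= neq_v g_mono; rewrite /block_letter /ltL.
rewrite -!pair_eqE /pair_eq /= in g_mono *.
have [fix_x|nfix_x] := boolP ((c == 0) && (v == i));
  have [fix_y|nfix_y] := boolP ((c' == 0) && (v' == i.+1)) => /=.
- lia.
- by clear g_mono; case: ifP => /=; lia.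
- by clear g_mono; case: ifP => /=; lia.
case: (g_mono nfix_x nfix_y) => g_lt g_gt; move: (g v) (g v') g_lt g_gt => gv gv'.
by do 2!case: ifP => /=; lia.
Qed.

Definition nonfix s := [seq i <- enum 'I_n | ~~ isfix s i].

Definition block_word d := [seq block_letter id i (xlet d i) | i : 'I_n <- nonfix d].

Lemma ltn_ord_trans : transitive (fun i j : 'I_n => i < j).
Proof. by move=> j i k /=; apply: ltn_trans. Qed.

Lemma nonfix_sorted s : sorted (fun i j : 'I_n => i < j) (nonfix s).
Proof.
apply: (sorted_filter ltn_ord_trans); rewrite -[sorted _ _]/(sorted (relpre val ltn) (enum 'I_n)).
rewrite -sorted_map val_enum_ord.
exact: iota_ltn_sorted.
Qed.

Lemma mem_nonfix s i : (i \in nonfix s) = ~~ isfix s i.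
Proof. by rewrite mem_filter mem_enum andbT. Qed.

Lemma nonfix_standardize s :
  nonfix (standardize s) = [seq standard_perm (fixmask s) i | i <- nonfix s].
Proof.
apply: (irr_sorted_eq ltn_ord_trans); first by move=> i; rewrite ltnn.
- exact: nonfix_sorted.
- have nfixs : all [pred i | ~~ isfix s i] (nonfix s) by exact: filter_all.
  apply: homo_sorted_in nfixs (nonfix_sorted s) => i j nfix_i nfix_j lt_ij /=.
  by rewrite !standard_permE standard_pos_nonfix.
move=> j; rewrite -[j](permKV (standard_perm (fixmask s))) mem_nonfix isfix_colconj.
by rewrite (mem_map perm_inj) mem_nonfix.
Qed.

(** The reason for the parameter [g]: the block letters of the standardized element can be read at
    the original positions, relabelled by [standard_pos]. *)
Lemma block_letter_standardize s i : ~~ isfix s i ->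
  block_letter id (standard_perm (fixmask s) i)
     (xlet (standardize s) (standard_perm (fixmask s) i))
  = block_letter (standard_pos (fixmask s)) i (xlet s i).
Proof.
move=> nfix_i; rewrite /block_letter -!/(isfix _ _) isfix_colconj (negbTE nfix_i).
rewrite xlet_colconj /= !standard_permE.
by rewrite standard_pos_nonfix ?isfix_image.
Qed.

(** Replacing each letter by its block letter keeps every descent, and fixed points all become
    [(0, 0)]; the remaining letters, in order, are those of the standardized element. *)
Lemma maj_word s :
  maj (word s) = maj (shuf (0, 0) (block_word (standardize s)) (fixmask s)).
Proof.
rewrite /block_word nonfix_standardize fixmaskE -map_comp.
rewrite (shuf_map _ (fun i : 'I_n => block_letter id _ (xlet _ (_ i)))).
rewrite (_ : [seq _ | i <- enum 'I_n] =
  [seq block_letter (standard_pos (fixmask s)) i (xlet s i) | i : 'I_n <- enum 'I_n]); last first.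
  apply: eq_map => i; case: ifPn => [fix_i | /block_letter_standardize //].
  by rewrite /block_letter -/(isfix _ _) fix_i.
apply: eq_maj => [|i]; first by rewrite !size_map.
rewrite size_map size_enum_ord => lt_i1.
pose i1 := Ordinal lt_i1; pose i0 := Ordinal (ltnW lt_i1).
rewrite !(nth_map i0) -?enumT ?size_enum_ord ?(ltnW lt_i1) //.
have Di0 : nth i0 (enum 'I_n) i = i0 by apply: val_inj; rewrite /= nth_enum_ord // ltnW.
have Di1 : nth i0 (enum 'I_n) i.+1 = i1 by apply: val_inj; rewrite /= nth_enum_ord.
rewrite Di0 Di1.
rewrite ltL_block_letter //= => [|nfix0 nfix1].
  by rewrite val_eqE (inj_eq perm_inj) -val_eqE /= ltn_eqF.
by split; apply: standard_pos_nonfix; apply: isfix_image.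
Qed.

Lemma rankv_mono (vals : seq nat) u v : u \in vals -> v \in vals ->
  (rankv vals u < rankv vals v) = (u < v).
Proof.
have rank_lt x y : y \in vals -> x < y -> rankv vals x < rankv vals y.
  move=> vals_y lt_xy; rewrite /rankv -add1n.
  have y_count : 0 < count (pred1 y) vals by rewrite -has_count has_pred1.
  apply: leq_trans (leq_add y_count (leqnn _)) _.
  rewrite -count_predUI [X in _ + X](eq_count (a2 := pred0)) => [|z /=]; last first.
    by case: eqP => // ->; rewrite leqNgt lt_xy.
  rewrite count_pred0 addn0; apply: sub_count => z /= /orP[/eqP-> //|/leq_trans->//].
  exact: ltnW.
move=> vals_u vals_v; case: (ltngtP u v) => [/rank_lt->//|/rank_lt lt_vu|->].
  by apply/negbTE; rewrite -leqNgt ltnW // lt_vu.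
by rewrite ltnn.
Qed.

Lemma size_nonfix d k : fixes_top d k -> size (nonfix d) = n - k.
Proof.
move=> /forallP top_d; rewrite size_filter.
have -> : count (fun i => ~~ isfix d i) (enum 'I_n) = count (fun i => i < n - k) (iota 0 n).
  rewrite -val_enum_ord count_map; apply: eq_count => i /=.
  by rewrite (eqP (top_d i)) -ltnNge.
rewrite -{2}(subnKC (leq_subr k n)) iotaD count_cat add0n.
rewrite (eq_in_count (a2 := predT)) => [|i]; last by rewrite mem_iota.
rewrite count_predT size_iota -[RHS]addn0; congr (_ + _).
rewrite (eq_in_count (a2 := pred0)) ?count_pred0 // => i; rewrite mem_iota => /andP[le_i _].
by rewrite ltnNge le_i.
Qed.

Lemma nth_nonfix d k i0 i : fixes_top d k -> i < n - k -> nth i0 (nonfix d) i = i :> nat.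
Proof.
move=> top_d lt_i; have size_d := size_nonfix top_d.
suff val_d : map val (nonfix d) = iota 0 (n - k).
  by rewrite -(nth_map i0 0 val) ?size_d // val_d nth_iota.
apply: (irr_sorted_eq ltn_trans ltnn); last 2 first.
- exact: iota_ltn_sorted.
- move=> j; rewrite mem_iota add0n /=; apply/mapP/idP => [[{}j + ->]|lt_j].
    by rewrite mem_nonfix (eqP (forallP top_d _)) -ltnNge.
  have lt_jn := leq_trans lt_j (leq_subr k n); exists (Ordinal lt_jn) => //.
  by rewrite mem_nonfix (eqP (forallP top_d _)) -ltnNge.
by rewrite sorted_map; apply: nonfix_sorted.
Qed.

Lemma fixes_top_standardize s : fixes_top (standardize s) (fixn s).
Proof. by rewrite fixn_count -fixmask_eq. Qed.

(** The [j]-th non-fixed position is standardized to [j], so [ltL_block_letter] applies to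
    neighbours. Rank and [standard_pos] both preserve the order of the absolute values that
    occur. *)
Lemma maj_Der s : maj (Der s) = maj (block_word (standardize s)).
Proof.
have top_d := fixes_top_standardize s; rewrite /block_word.
have size_s : size (nonfix s) = n - fixn s.
  by rewrite -(size_nonfix top_d) nonfix_standardize size_map.
rewrite /Der /nonfix_word -/(nonfix s).
apply: eq_maj => [|j]; first by rewrite nonfix_standardize !size_map.
rewrite 2!size_map size_s => lt_j1; have lt_j := ltnW lt_j1.
have i0 : 'I_n by case: (nonfix s) size_s lt_j => [/= <-|].
have nth_d r : r < n - fixn s ->
    standard_perm (fixmask s) (nth i0 (nonfix s) r) = r :> nat.
  by move=> lt_r; have := nth_nonfix i0 top_d lt_r; rewrite nonfix_standardize (nth_map i0) ?size_s.
have nfix r : r < n - fixn s -> ~~ isfix s (nth i0 (nonfix s) r).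
  by move=> lt_r; rewrite -mem_nonfix mem_nth ?size_s.
rewrite nonfix_standardize !(nth_map (0, 0)) ?size_map ?size_s //.
rewrite !(nth_map i0) ?size_map ?size_s //.
have := nth_d _ lt_j; have := nth_d _ lt_j1; have := nfix _ lt_j; have := nfix _ lt_j1.
set i := nth i0 _ j; set i' := nth i0 _ j.+1 => nfix_i' nfix_i Di' Di.
rewrite Di' Di ltL_block_letter; first last.
- by [].
- rewrite !xlet_colconj /= val_eqE !(inj_eq perm_inj).
  by apply/eqP => Dii; move: Di' Di; rewrite Dii => -> /eqP; rewrite gtn_eqF.
rewrite !xlet_colconj /= /ltL /= !standard_permE.
rewrite rankv_mono ?standard_pos_mono ?size_tuple ?nth_fixmask ?isfix_image //.
- by rewrite -map_comp; apply: map_f; rewrite mem_nonfix.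
- by rewrite -map_comp; apply: map_f; rewrite mem_nonfix.
Qed.

Lemma maf_mask s :
  maf s = maj (block_word (standardize s)) + mask_inv (fixmask s).
Proof.
rewrite /maf maj_Der; congr (_ + _).
suff -> : fixpos s = [seq i <- iota 0 (size (fixmask s)) | nth false (fixmask s) i] by [].
rewrite size_tuple -val_enum_ord filter_map; congr map.
by apply: eq_filter => i; rewrite /= nth_fixmask.
Qed.

Lemma size_block_word d k : fixes_top d k -> size (block_word d) = n - k.
Proof. by move=> top_d; rewrite size_map (size_nonfix top_d). Qed.

(** Supplies the hypothesis of [shuffle_maj] that the repeated letter is absent from the word. *)
Lemma block_word_pivot d : (0, 0) \notin block_word d.
Proof.
apply/mapP => -[i]; rewrite mem_nonfix /block_letter -/(isfix _ _) => /negbTE->.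
by case: ifP.
Qed.

(** Each element is obtained once from its standardization [d] and its fixed-point mask [b]; the
    index [k] is the common number of fixed points. *)
Lemma colperm_sum (R : nmodType) (F : colperm l n -> R) :
  (\sum_s F s = \sum_(k < n.+1) \sum_(d | fixes_top d k)
     \sum_(b : n.-tuple bool | count_mem true b == k)
        F (colconj d (standard_perm b)^-1))%R.
Proof.
rewrite (partition_big fixmask xpredT) //=.
rewrite (partition_big (fun b : n.-tuple bool => inord (count_mem true b) : 'I_n.+1) xpredT) //=.
apply: eq_bigr => k _; rewrite [RHS]exchange_big /=.
apply: eq_big => [b | b /eqP <-].
  rewrite -val_eqE /= inordK // ltnS -{2}(size_tuple b); exact: count_size.
rewrite inordK; last by rewrite ltnS -{2}(size_tuple b); exact: count_size.
rewrite (reindex (colconj^~ (standard_perm b)^-1)%g) /=; last first.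
  by apply/onW_bij; exists (colconj^~ (standard_perm b)); [apply: colconjVK | apply: colconjK].
by apply: eq_bigl => d; rewrite fixmask_eq colconjVK.
Qed.

Section Destandardize.
Variables (b : n.-tuple bool) (k : nat) (d : colperm l n).
Hypotheses (top_d : fixes_top d k) (count_b : count_mem true b = k).
Let s := colconj d (standard_perm b)^-1.

Lemma fixmask_destandardize : fixmask s = b.
Proof. by apply/eqP; rewrite fixmask_eq colconjVK count_b. Qed.

Lemma destandardizeK : standardize s = d.
Proof. by rewrite /standardize fixmask_destandardize colconjVK. Qed.

Lemma fixn_destandardize : fixn s = k.
Proof. by rewrite fixn_count fixmask_destandardize. Qed.

Lemma exc_destandardize : exc s = exc d.
Proof. by rewrite -[in RHS]destandardizeK exc_standardize. Qed.

Lemma fmaj_destandardize :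
  fmaj s = l * maj (shuf (0, 0) (block_word d) b) + Defs.col d.
Proof.
by rewrite /fmaj /majp maj_word destandardizeK fixmask_destandardize col_colconj.
Qed.

Lemma fmaf_destandardize :
  fmaf s = l * (maj (block_word d) + mask_inv b) + Defs.col d.
Proof. by rewrite /fmaf maf_mask destandardizeK fixmask_destandardize col_colconj. Qed.

End Destandardize.

(** * Generating functions of fmaj and fmaf over standardized elements *)

Section GeneratingFunctions.
Local Open Scope ring_scope.
Variables (R : comNzRingType) (q : R) (h : nat -> nat -> R).

(** The weight [h] is arbitrary so that one identity serves twice: an indicator gives the joint
    distribution, and a power of $x$ gives the closed formula. *)
Definition top_sum k : R :=
  \sum_(d | fixes_top d k) q ^+ (l * maj (block_word d) + Defs.col d) * h (exc d) k.

Lemma fmaj_sum :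
  \sum_(s : colperm l n) q ^+ fmaj s * h (exc s) (fixn s)
    = \sum_(k < n.+1) gauss (q ^+ l) n k * top_sum k.
Proof.
rewrite colperm_sum; apply: eq_bigr => k _; rewrite mulr_sumr; apply: eq_bigr => d top_d.
under eq_bigr => b /eqP count_b.
  rewrite (fmaj_destandardize top_d count_b) (exc_destandardize top_d count_b).
  rewrite (fixn_destandardize top_d count_b) exprD exprM.
  over.
rewrite -!mulr_suml (shuffle_maj _ _ (block_word_pivot d)); last first.
  by rewrite (size_block_word top_d) subnK // -ltnS.
by rewrite exprD exprM -!mulrA mulrCA.
Qed.

Lemma fmaf_sum :
  \sum_(s : colperm l n) q ^+ fmaf s * h (exc s) (fixn s)
    = \sum_(k < n.+1) gauss (q ^+ l) n k * top_sum k.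
Proof.
rewrite colperm_sum; apply: eq_bigr => k _; rewrite mulr_sumr; apply: eq_bigr => d top_d.
under eq_bigr => b /eqP count_b.
  rewrite (fmaf_destandardize top_d count_b) (exc_destandardize top_d count_b).
  rewrite (fixn_destandardize top_d count_b) exprD exprM exprD.
  over.
rewrite -!mulr_suml -mulr_sumr mask_inv_sum.
by rewrite exprD exprM -!mulrA mulrCA.
Qed.

End GeneratingFunctions.

End Conjugation.

(** * Insertion of the largest absolute value *)

Section Insertion.
Variables l n : nat.

Definition insert (x : 'I_n.+1 * 'I_l * colperm l n) : colperm l n.+1 :=
  (lift_perm x.1.1 ord_max x.2.1,
   [ffun k => if unlift x.1.1 k is Some k' then x.2.2 k' else x.1.2]).

(** Injectivity suffices, as both sides have $(n+1)!\,l^{n+1}$ elements. *)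
Lemma insert_bij : bijective insert.
Proof.
apply: inj_card_bij; last first.
  rewrite !card_prod !card_ffun !card_Sn !card_ord factS expnS.
  by rewrite -!mulnA leq_mul2l /= mulnCA.
move=> [[i j] [p c]] [[i' j'] [p' c']] [eq_p eq_c].
have Di : i = i'.
  apply: (@perm_inj _ (lift_perm i ord_max p)).
  by rewrite lift_perm_id eq_p lift_perm_id.
subst i'; have Dp : p = p'.
  apply/permP => k; apply: (@lift_inj _ ord_max).
  by rewrite -(lift_perm_lift i) eq_p lift_perm_lift.
move/ffunP: eq_c => eq_c; have := eq_c i; rewrite !ffunE unlift_none => ->.
rewrite Dp; congr (_, (_, _)); apply/ffunP => k.
by have := eq_c (lift i k); rewrite !ffunE liftK.
Qed.

Lemma xlet_insert_self i j s : xlet (insert (i, j, s)) i = (val j, n).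
Proof. by rewrite /xlet /= lift_perm_id ffunE unlift_none. Qed.

Lemma xlet_insert_lift i j s k : xlet (insert (i, j, s)) (lift i k) = xlet s k.
Proof. by rewrite /xlet /= lift_perm_lift ffunE liftK lift_max. Qed.

Lemma enum_lift (i : 'I_n.+1) :
  [seq k <- enum 'I_n.+1 | k != i] = [seq lift i k | k <- enum 'I_n].
Proof.
apply: (irr_sorted_eq (@ltn_ord_trans n.+1)); first by move=> k; rewrite ltnn.
- apply: (sorted_filter (@ltn_ord_trans _)).
  rewrite -[sorted _ _]/(sorted (relpre val ltn) (enum 'I_n.+1)).
  rewrite -sorted_map val_enum_ord; exact: iota_ltn_sorted.
- rewrite sorted_map; have := iota_ltn_sorted 0 n; rewrite -val_enum_ord sorted_map.
  apply: sub_sorted => k k' /= lt_k; rewrite /bump; lia.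
move=> k; rewrite mem_filter mem_enum andbT; apply/idP/mapP => [neq_ki | [k' _ ->]].
  by case: (unliftP i k) neq_ki => [k' ->|->]; [exists k'; rewrite ?mem_enum | rewrite eqxx].
by rewrite eq_sym neq_lift.
Qed.

Lemma word_insert i j s :
  word (insert (i, j, s)) = shuf (val j, n) (word s) [seq k == i | k <- enum 'I_n.+1].
Proof.
have -> : word s = [seq xlet (insert (i, j, s)) k | k <- enum 'I_n.+1 & k != i].
  by rewrite enum_lift -map_comp; apply: eq_map => k; rewrite /= xlet_insert_lift.
rewrite (shuf_map _ (xlet (insert (i, j, s))) (pred1 i)); apply: eq_map => k.
by rewrite /=; case: (k =P i) => [->|_]; rewrite ?xlet_insert_self.
Qed.

Lemma col_insert i j s : Defs.col (insert (i, j, s)) = j + Defs.col s.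
Proof.
rewrite /Defs.col (bigD1_ord i) //= ffunE unlift_none; congr (_ + _).
by apply: eq_bigr => k _; rewrite ffunE liftK.
Qed.

Section Total.
Local Open Scope ring_scope.
Variables (R : comNzRingType) (q : R).

(** This is $[m]_{q^l}[l]_q = [ml]_q$, by division with remainder of the exponents by $l$. *)
Lemma gauss1_qint m : gauss (q ^+ l) m 1 * (\sum_(j < l) q ^+ j) = qint q (m * l).
Proof.
rewrite gauss1 /qint; elim: m => [|m IH]; first by rewrite !big_ord0 mul0r.
rewrite big_ord_recr /= mulrDl IH mulSn addnC big_split_ord /=; congr (_ + _).
by rewrite mulr_sumr; apply: eq_bigr => j _; rewrite exprD mulnC exprM.
Qed.

(** For each colour of the new letter the shuffle with $k=1$ contributes $[n+1]_Q$; the colours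
    themselves contribute $[l]_q$. *)
Lemma sum_fmajS :
  \sum_(s : colperm l n.+1) q ^+ fmaj s
    = qint q (n.+1 * l) * \sum_(s : colperm l n) q ^+ fmaj s.
Proof.
rewrite (reindex insert) /=; last exact/onW_bij/insert_bij.
transitivity (\sum_(i < n.+1) \sum_(j < l) \sum_(s : colperm l n) q ^+ fmaj (insert (i, j, s))).
  by rewrite pair_bigA pair_bigA; apply: eq_bigr => -[[]].
rewrite exchange_big /= -gauss1_qint [_ * (\sum_(j < l) _)]mulrC -mulrA mulr_suml.
apply: eq_bigr => j _; rewrite exchange_big /= !mulr_sumr; apply: eq_bigr => s _.
under eq_bigr => i _.
  rewrite /fmaj /majp word_insert col_insert exprD exprM; over.
rewrite -mulr_suml -(mask_sum1 _ (fun b => (q ^+ l) ^+ maj (shuf (val j, n) (word s) b))).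
rewrite shuffle_maj; first last.
- apply/mapP => -[k _ [_ /eqP]]; by rewrite gtn_eqF.
- by rewrite size_map size_enum_ord addn1.
by rewrite /fmaj !exprD exprM -!mulrA mulrCA [in RHS]mulrCA; congr (_ * _); rewrite mulrCA.
Qed.

End Total.


Lemma isfix_insert_self i (j : 'I_l) s :
  isfix (insert (i, j, s)) i = (i == ord_max) && (j == 0 :> nat).
Proof.
rewrite /isfix xlet_insert_self -!pair_eqE /pair_eq /= andbC; congr (_ && _).
by rewrite -val_eqE eq_sym.
Qed.

Lemma isfix_insert_lift j s k :
  isfix (insert (ord_max, j, s)) (lift ord_max k) = isfix s k.
Proof. by rewrite /isfix xlet_insert_lift [val (lift _ _)]lift_max. Qed.

Lemma nonfix_insert (j : 'I_l) s : j = 0 :> nat ->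
  nonfix (insert (ord_max, j, s)) = [seq lift ord_max k | k <- nonfix s].
Proof.
move=> j0; rewrite /nonfix (eq_filter (a2 := predI
   (fun k => ~~ isfix (insert (ord_max, j, s)) k) (fun k => k != ord_max))).
  rewrite filter_predI enum_lift filter_map; congr map.
  by apply: eq_filter => k; rewrite /= isfix_insert_lift.
move=> k /=; case: eqP => [->|_]; last by rewrite andbT.
by rewrite isfix_insert_self eqxx j0.
Qed.

Lemma block_word_insert (j : 'I_l) s : j = 0 :> nat ->
  block_word (insert (ord_max, j, s)) = block_word s.
Proof.
move=> j0; rewrite /block_word nonfix_insert // -map_comp.
by apply: eq_map => k; rewrite /= xlet_insert_lift /bump leqNgt ltn_ord.
Qed.

Lemma fixes_top_insert i (j : 'I_l) s k : k <= n ->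
  fixes_top (insert (i, j, s)) k.+1
    = [&& i == ord_max, j == 0 :> nat & fixes_top s k].
Proof.
move=> le_kn; rewrite /fixes_top subSS; apply/forallP/and3P => [top_s | [/eqP-> j0 top_s] r].
  have : isfix (insert (i, j, s)) ord_max by rewrite (eqP (top_s _)) leq_subr.
  case: (unliftP i ord_max) => [r Dr | Di]; last first.
    move: top_s; rewrite -Di isfix_insert_self => top_s /andP[_ j0]; split=> //.
    by apply/forallP => r; have := top_s (lift ord_max r); rewrite isfix_insert_lift lift_max.
  rewrite Dr /isfix xlet_insert_lift -Dr => /eqP[_ Es].
  by have := ltn_ord (s.1 r); rewrite Es ltnn.
case: (unliftP ord_max r) => [r' -> | ->].
  by rewrite isfix_insert_lift lift_max (forallP top_s).
by rewrite isfix_insert_self eqxx j0 leq_subr.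
Qed.

End Insertion.

(** * Derangement sums and the total sum of $q^{\mathrm{fmaj}}$ *)

Section Formula.
Local Open Scope ring_scope.
Variables (R : comNzRingType) (q : R) (l : nat).
Hypothesis l_gt0 : (0 < l)%N.

(** [der_sum n 0] is the derangement sum $D_n$; the case of general [k] reduces to it by removing
    the final fixed points one at a time. *)
Definition der_sum n k : R :=
  \sum_(d : colperm l n | fixes_top d k) q ^+ (l * maj (block_word d) + Defs.col d).

Lemma der_sumS n k : (k <= n)%N -> der_sum n.+1 k.+1 = der_sum n k.
Proof.
move=> le_kn; pose j0 := Ordinal l_gt0; have [inv insertK insertVK] := insert_bij l n.
rewrite /der_sum (reindex (fun s => insert (ord_max, j0, s))) /=.
  apply: eq_big => [s|s _]; first by rewrite fixes_top_insert // eqxx.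
  by rewrite block_word_insert // col_insert.
exists (fun d => (inv d).2) => [s _ | d]; first by rewrite insertK.
rewrite inE -{1}[d]insertVK; case E: (inv d) => [[i j] s].
rewrite fixes_top_insert // => /and3P[/eqP Di /eqP Dj _] /=.
by rewrite -[RHS]insertVK E Di; congr (insert (_, _, _)); apply: val_inj.
Qed.

Lemma der_sum_sub n k : (k <= n)%N -> der_sum n k = der_sum (n - k) 0.
Proof.
elim: n k => [|n IH] [|k] // le_kn.
by rewrite der_sumS // IH.
Qed.

Lemma sum_fmaj_fixn n (x : R) :
  \sum_(s : colperm l n) q ^+ fmaj s * x ^+ fixn s
    = \sum_(k < n.+1) gauss (q ^+ l) n k * (x ^+ k * der_sum (n - k) 0).
Proof.
rewrite (fmaj_sum l n q (fun _ k => x ^+ k)); apply: eq_bigr => k _; congr (_ * _).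
by rewrite /top_sum -mulr_suml mulrC -der_sum_sub // -ltnS.
Qed.

Lemma sum_fmaj n :
  \sum_(s : colperm l n) q ^+ fmaj s = \prod_(i < n) qint q (i.+1 * l).
Proof.
elim: n => [|n IH]; last by rewrite sum_fmajS IH big_ord_recr mulrC.
have card0 : #|{: colperm l 0}| = 1%N.
  by rewrite card_prod card_ffun card_Sn !card_ord expn0.
have [s0 Ds0] := fintype1 card0.
rewrite big_ord0 (big_pred1 s0) => [|s]; last by rewrite [s]Ds0 /= eqxx.
by rewrite /fmaj /majp /maj /Defs.col size_map size_enum_ord !big_ord0 muln0.
Qed.

Lemma prod_qint_recursion n :
  \prod_(i < n) qint q (i.+1 * l)
    = \sum_(k < n.+1) gauss (q ^+ l) n k * der_sum (n - k) 0.
Proof.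
rewrite -sum_fmaj; have := sum_fmaj_fixn n 1.
under eq_bigr => s _ do rewrite expr1n mulr1.
by move=> ->; apply: eq_bigr => k _; rewrite expr1n mul1r.
Qed.

End Formula.

(** * The closed formula over a field *)

Section FieldFormula.
Local Open Scope ring_scope.
Variables (R : fieldType) (q : R) (l n : nat).
Hypothesis l_gt0 : (0 < l)%N.
Hypothesis qint_neq0 : forall i, (1 <= i <= n)%N -> qint q (i * l) != 0.

Let Q := q ^+ l.
Let qprod m := \prod_(i < m) qint q (i.+1 * l).

Lemma qprod_neq0 m : (m <= n)%N -> qprod m != 0.
Proof.
move=> le_mn; apply/prodf_neq0 => i _; apply: qint_neq0.
exact: leq_trans (ltn_ord i) le_mn.
Qed.

Lemma gauss_qprod m k : (k <= m)%N ->
  gauss Q m k * (qprod k * qprod (m - k)) = qprod m.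
Proof.
have qprodE r : qprod r = (\prod_(i < r) gauss Q i.+1 1) * (\sum_(j < l) q ^+ j) ^+ r.
  rewrite -[r in _ ^+ r]card_ord -prodr_const -big_split /=.
  by apply: eq_bigr => i _; rewrite -gauss1_qint.
move=> le_km; rewrite !qprodE -(gauss_fact Q le_km).
by rewrite mulrACA -exprD subnKC // [LHS]mulrA.
Qed.

(** Multiplied by the nonzero [qprod k * qprod (r - k) * qprod (n - r)], both sides become
    [qprod n]. *)
Lemma gauss_trinomial r k : (k <= r)%N -> (r <= n)%N ->
  gauss Q n r * gauss Q r k = gauss Q n k * gauss Q (n - k) (r - k).
Proof.
move=> le_kr le_rn; have le_kn := leq_trans le_kr le_rn.
have nz : qprod k * qprod (r - k) * qprod (n - r) != 0.
  by rewrite !mulf_neq0 ?qprod_neq0 // (leq_trans (leq_subr _ _)).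
apply: (mulIf nz).
have := @gauss_qprod (n - k) (r - k); rewrite leq_sub2r // => /(_ isT).
rewrite (_ : n - k - (r - k) = n - r)%N; last by lia.
move: (gauss_qprod le_rn) (gauss_qprod le_kr) (gauss_qprod le_kn).
move: (gauss Q n r) (gauss Q r k) (gauss Q n k) (gauss Q _ _) => A B C D.
move: (qprod k) (qprod (r - k)) (qprod (n - r)) (qprod (n - k)) => a b c d.
move: (qprod r) (qprod n) => e f ABf Be Cf Dd.
by transitivity f; [rewrite -ABf -Be | rewrite -Cf -Dd]; ring.
Qed.

Lemma sum_fmaj_fixn_formula (x : R) :
  \sum_(s : colperm l n) q ^+ fmaj s * x ^+ fixn s
    = (\prod_(1 <= i < n.+1) qint q (i * l)) *
      \sum_(k < n.+1) (\prod_(i < k) (x - q ^+ (l * i))) /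
        (\prod_(1 <= i < k.+1) qint q (i * l)).
Proof.
have qprodE m : \prod_(1 <= i < m.+1) qint q (i * l) = qprod m.
  by rewrite big_add1 big_mkord.
rewrite sum_fmaj_fixn // qprodE mulr_sumr.
pose P k := \prod_(i < k) (x - Q ^+ i).
transitivity (\sum_(r < n.+1) \sum_(k < n.+1 | (k <= r)%N)
    gauss Q n r * gauss Q r k * der_sum q l (n - r) 0 * P k).
  apply: eq_bigr => r _; rewrite (gauss_expansion Q x r).
  rewrite (big_ord_widen n.+1 (fun k => gauss Q r k * P k)) //.
  by rewrite mulr_suml mulr_sumr; apply: eq_bigr => k _; ring.
rewrite (exchange_big_dep xpredT) //=; apply: eq_bigr => k _.
have le_kn : (k <= n)%N by rewrite -ltnS.
(* After the exchange of sums, [gauss_trinomial] moves [gauss Q n k] out, and the inner sum over $r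
   = j+k$ is the recursion for [qprod (n - k)]. *)
transitivity (gauss Q n k * qprod (n - k) * P k); last first.
  rewrite qprodE -(gauss_qprod le_kn).
  have -> : P k = \prod_(i < k) (x - q ^+ (l * i)).
    by apply: eq_bigr => i _; rewrite -exprM.
  field. exact: qprod_neq0.
rewrite /qprod prod_qint_recursion // -/Q mulr_sumr mulr_suml -subSn //.
rewrite -(big_geq_mkord k n.+1 xpredT
  (fun r => gauss Q n r * gauss Q r k * der_sum q l (n - r) 0 * P k)).
rewrite -{1}[k : nat]add0n big_addn big_mkord; apply: eq_bigr => j _.
have le_jkn : (j + k <= n)%N by have := ltn_ord j; lia.
rewrite gauss_trinomial ?leq_addl // addnK addnC subnDA; ring.
Qed.

End FieldFormula.

Theorem theorem1 (l n : nat) (hl : 1 <= l) (hn : 1 <= n) :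
  (forall a b c : nat,
     #|[pred s : colperm l n | (fmaf s == a) && (exc s == b) && (fixn s == c)]|
   = #|[pred s : colperm l n | (fmaj s == a) && (exc s == b) && (fixn s == c)]|)
  /\
  (forall (R : fieldType) (q x : R),
     (forall i, 1 <= i <= n -> qint q (i * l) != 0%R) ->
     (\sum_(s : colperm l n) q ^+ fmaf s * x ^+ fixn s
        = \sum_(s : colperm l n) q ^+ fmaj s * x ^+ fixn s)%R /\
     (\sum_(s : colperm l n) q ^+ fmaj s * x ^+ fixn s
        = (\prod_(1 <= i < n.+1) qint q (i * l)) *
          \sum_(k < n.+1)
            (\prod_(i < k) (x - q ^+ (l * i))) /
            (\prod_(1 <= i < k.+1) qint q (i * l)))%R).
Proof.
split=> [a b c | R q x qint_neq0]; last first.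
  split; last exact: sum_fmaj_fixn_formula.
  by rewrite (fmaf_sum l n q (fun _ k => x ^+ k)%R) (fmaj_sum l n q (fun _ k => x ^+ k)%R).
(* Equidistribution is read off with $q = X$ over the integers: for this indicator weight, the
   coefficient of $X^a$ counts the elements with statistics $(a,b,c)$. *)
pose h (e f : nat) : {poly int} := ((e == b) && (f == c))%:R%R.
have cardE (st : colperm l n -> nat) :
    (#|[pred s : colperm l n | (st s == a) && (exc s == b) && (fixn s == c)]|%:R
      = (\sum_s 'X ^+ st s * h (exc s) (fixn s))`_a :> int)%R.
  rewrite coef_sum -sum1_card natr_sum big_mkcond; apply: eq_bigr => s _.
  rewrite inE /h -andbA (eq_sym _ a); case: (_ && (fixn s == c)).
    by rewrite mulr1 coefXn andbT; case: eqP.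
  by rewrite mulr0 coef0 andbF.
apply/eqP; rewrite -(eqr_nat int) !cardE; apply/eqP.
by rewrite (fmaf_sum l n 'X h) (fmaj_sum l n 'X h).
Qed.
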